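(* Fix a species $h$ with mass $m_h>0$ and charge $q_h$, and let $\boldsymbol{\alpha}^{\perp}\in C^2(\mathbb{R},\mathbb{R}^2)$ with $\boldsymbol{\alpha}^{\perp}(\xi)=0$ for $\xi\le0$. Let $\boldsymbol{u}_h^{(0)}=(\boldsymbol{u}_h^{\perp(0)},u_h^{z(0)})$, $\gamma_h^{(0)}$, $\boldsymbol{\beta}_h^{(0)}$, $\boldsymbol{Y}_h=(\boldsymbol{Y}_h^\perp,Y_h^3)$ and $\Xi_h$ be the functions of one real variable $\xi$ defined from $\boldsymbol{\alpha}^\perp$ in the context. Consider the ODE problem $$\partial_0\boldsymbol{x}_h(x^0,\boldsymbol{X})=\boldsymbol{\beta}_h^{(0)}\big(x^0-z_h(x^0,\boldsymbol{X})\big),\qquad \boldsymbol{x}_h(x^0,\boldsymbol{X})=\boldsymbol{X}\ \text{ for } x^0\le Z,$$ where $\boldsymbol{x}_h=(\boldsymbol{x}_h^\perp,z_h)\in\mathbb{R}^3$ and $\boldsymbol{X}=(\boldsymbol{X}^\perp,Z)\in\mathbb{R}^3$. Its solution $\boldsymbol{x}_h^{(0)}(x^0,\boldsymbol{X})=(\boldsymbol{x}_h^{\perp(0)},z_h^{(0)})$ and, for each fixed $x^0$, the inverse $\boldsymbol{X}_h^{(0)}(x^0,\boldsymbol{x})=(\boldsymbol{X}_h^{\perp(0)},Z_h^{(0)})$ of the map $\boldsymbol{X}\mapsto\boldsymbol{x}_h^{(0)}(x^0,\boldsymbol{X})$ are given by $$z_h^{(0)}(x^0,Z)=x^0-\Xi_h^{-1}(x^0-Z),$$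 $$Z_h^{(0)}(x^0,z)=x^0-\Xi_h(x^0-z)=z-Y_h^3(x^0-z),$$ $$\boldsymbol{x}_h^{\perp(0)}(x^0,\boldsymbol{X})=\boldsymbol{X}^\perp+\boldsymbol{Y}_h^\perp\big[x^0-z_h^{(0)}(x^0,Z)\big],$$ $$\boldsymbol{X}_h^{\perp(0)}(x^0,\boldsymbol{x})=\boldsymbol{x}^\perp-\boldsymbol{Y}_h^\perp(x^0-z).$$ Moreover these functions fulfil $$\partial_0Z_h^{(0)}=-u_h^{z(0)},\qquad \partial_zZ_h^{(0)}=\gamma_h^{(0)},\qquad \partial_Zz_h^{(0)}=\frac1{\tilde\gamma_h^{(0)}},\qquad \partial_Z\boldsymbol{x}_h^{\perp(0)}=-\tilde{\boldsymbol{\beta}}_h^{\perp(0)},$$ where in the first two relations the right-hand sides are evaluated at $x^0-z$, and in the last two a tilde denotes evaluation at $x^0-z_h^{(0)}(x^0,Z)$.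
   Context: $c>0$ is the speed of light, $x^0=ct$, $\boldsymbol{x}=(\boldsymbol{x}^\perp,z)$ with $\boldsymbol{x}^\perp\in\mathbb{R}^2$; $\boldsymbol{x}_h(x^0,\boldsymbol{X})$ is the position at time $x^0$ of the fluid element (or test particle) initially located at $\boldsymbol{X}$, and $\partial_0=\partial/\partial x^0$. Definitions, for $\xi\in\mathbb{R}$: $$\boldsymbol{u}_h^{\perp(0)}(\xi):=\frac{-q_h}{m_hc^2}\boldsymbol{\alpha}^\perp(\xi),\quad u_h^{z(0)}:=\tfrac12|\boldsymbol{u}_h^{\perp(0)}|^2,\quad \gamma_h^{(0)}:=1+u_h^{z(0)},\quad \boldsymbol{\beta}_h^{(0)}:=\frac{\boldsymbol{u}_h^{(0)}}{\gamma_h^{(0)}},$$ $$\boldsymbol{Y}_h(\xi):=\int_0^\xi\boldsymbol{u}_h^{(0)}(\xi')\,d\xi',\qquad \Xi_h(\xi):=\int_0^\xi\gamma_h^{(0)}(\xi')\,d\xi'=\xi+Y_h^3(\xi).$$ $\Xi_h$ is strictly increasing, hence invertible; $\Xi_h^{-1}$ denotes its inverse function. *)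

(* Defs.v *)
(* Stdlib reals with Coquelicot. *)
From Stdlib Require Import Reals.
From Coquelicot Require Import Coquelicot.
Open Scope R_scope.

(* A vector x = (x^perp, z) of R^3 is a pair; [fst] and [snd] are its transverse
   and longitudinal parts.  Coquelicot's product norm is the Euclidean one. *)
Notation R2 := (R * R)%type.
Notation R3 := ((R * R) * R)%type.

Definition is_C2 (f : R -> R) : Prop :=
  (forall x, ex_derive_n f 1 x) /\ (forall x, ex_derive_n f 2 x) /\
  (forall x, continuous (Derive_n f 2) x).

Definition is_C2_vec (f : R -> R2) : Prop :=
  is_C2 (fun x => fst (f x)) /\ is_C2 (fun x => snd (f x)).

Definition u_perp (c m q : R) (alpha : R -> R2) (xi : R) : R2 :=
  scal (- q / (m * c ^ 2)) (alpha xi).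

Definition u_z (c m q : R) (alpha : R -> R2) (xi : R) : R :=
  / 2 * norm (u_perp c m q alpha xi) ^ 2.

Definition u_vec (c m q : R) (alpha : R -> R2) (xi : R) : R3 :=
  (u_perp c m q alpha xi, u_z c m q alpha xi).

Definition gamma (c m q : R) (alpha : R -> R2) (xi : R) : R :=
  1 + u_z c m q alpha xi.

Definition beta (c m q : R) (alpha : R -> R2) (xi : R) : R3 :=
  scal (/ gamma c m q alpha xi) (u_vec c m q alpha xi).

Definition Y_vec (c m q : R) (alpha : R -> R2) (xi : R) : R3 :=
  ((RInt (fun s => fst (u_perp c m q alpha s)) 0 xi,
    RInt (fun s => snd (u_perp c m q alpha s)) 0 xi),
   RInt (fun s => u_z c m q alpha s) 0 xi).

Definition Xi (c m q : R) (alpha : R -> R2) (xi : R) : R :=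
  RInt (fun s => gamma c m q alpha s) 0 xi.

(* [iota] picks the unique solution, so this is the inverse function of [Xi]
   exactly when [Xi] is a bijection of R. *)
Definition Xi_inv (c m q : R) (alpha : R -> R2) (y : R) : R :=
  iota (fun xi : R => Xi c m q alpha xi = y).

Definition is_solution (c m q : R) (alpha : R -> R2)
    (x : R -> R3 -> R3) : Prop :=
  (forall (x0 : R) (X : R3),
     is_derive (fun t : R => x t X) x0 (beta c m q alpha (x0 - snd (x x0 X)))) /\
  (forall (x0 : R) (X : R3), x0 <= snd X -> x x0 X = X).

(* Main.v *)
(* Along any solution the retarded time [w(t) = t - z(t)] satisfies
   [w' = 1 - u^z/gamma = 1/gamma(w)], so [Xi(w(t))] has derivative 1 and
   [x^perp(t) - Y^perp(w(t))] has derivative 0.  Hence [(x^perp - Y^perp(w), t - Xi(w))]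
   is a conserved quantity, equal to [X]: this gives the solution, its
   uniqueness and its inverse at once.  Since [gamma >= 1], [Xi] is a bijection
   of R with [(Xi^-1)' = 1/gamma]. *)
Require Import Defs.
From Stdlib Require Import Reals Lra Ranalysis5.
From Coquelicot Require Import Coquelicot.
Open Scope R_scope.

(** * Differentiation of pairs, integrals and inverse functions *)

Lemma is_derive_pair {V W : NormedModule R_AbsRing} (f : R -> V) (g : R -> W)
    (x : R) (df : V) (dg : W) :
  is_derive f x df -> is_derive g x dg ->
  is_derive (fun t => (f t, g t) : prod_NormedModule R_AbsRing V W) x (df, dg).
Proof.
  intros Hf Hg.
  refine (filterdiff_ext_lin _ (fun y : R => (scal y df, scal y dg)) _ _ _).
  (* Pairing is linear, hence its own differential, so the two-argument chain rule applies. *)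
  - refine (filterdiff_comp_2 (W := prod_NormedModule R_AbsRing V W)
              f g (fun u v => (u, v)) _ _ (fun u v => (u, v)) Hf Hg _).
    apply filterdiff_linear, is_linear_prod; [apply is_linear_fst | apply is_linear_snd].
  - intros y; reflexivity.
Qed.

Lemma is_derive_fst {V W : NormedModule R_AbsRing}
    (f : R -> prod_NormedModule R_AbsRing V W) (x : R)
    (l : prod_NormedModule R_AbsRing V W) :
  is_derive f x l -> is_derive (fun t => fst (f t)) x (fst l).
Proof.
  intros Hf.
  exact (filterdiff_comp' f (fun p => fst p) x _ (fun p => fst p) Hf
           (filterdiff_linear _ is_linear_fst)).
Qed.

Lemma is_derive_snd {V W : NormedModule R_AbsRing}
    (f : R -> prod_NormedModule R_AbsRing V W) (x : R)
    (l : prod_NormedModule R_AbsRing V W) :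
  is_derive f x l -> is_derive (fun t => snd (f t)) x (snd l).
Proof.
  intros Hf.
  exact (filterdiff_comp' f (fun p => snd p) x _ (fun p => snd p) Hf
           (filterdiff_linear _ is_linear_snd)).
Qed.

Lemma is_derive_RInt_continuous (f : R -> R) (a x : R) :
  (forall t, continuous f t) -> is_derive (fun y => RInt f a y) x (f x).
Proof.
  intros Hf.
  apply (is_derive_RInt f _ a); [|apply Hf].
  apply filter_forall; intros y.
  apply (RInt_correct f), (ex_RInt_continuous f); intros; apply Hf.
Qed.

Lemma is_derive_increasing (f df : R -> R) :
  (forall x, is_derive f x (df x)) -> (forall x, 0 < df x) ->
  forall a b, a < b -> f a < f b.
Proof.
  intros Hf Hp a b Hab.
  apply (incr_function f m_infty p_infty df); simpl; auto; intros; apply Hp.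
Qed.

(** A right inverse suffices: [f] is strictly increasing, so it reflects the order, which makes [g]
    monotone and continuous; the classical rule on an interval then applies. *)
Lemma is_derive_inverse (f df g : R -> R) :
  (forall x, is_derive f x (df x)) -> (forall x, 0 < df x) ->
  (forall y, f (g y) = y) ->
  forall y, is_derive g y (/ df (g y)).
Proof.
  intros Hf Hp Hfg y.
  assert (Hinc := is_derive_increasing f df Hf Hp).
  assert (Hmon : forall a b, f a <= f b -> a <= b).
  { intros a b Hab; destruct (Rle_or_lt a b) as [H|H]; [easy|].
    specialize (Hinc b a H); lra. }
  (* [g y] is interior to the interval of radius 1 around it, so strict monotonicity puts [y]
     strictly between the values of [f] at the endpoints. *)
  assert (Hc : continuity_pt g y).
  { apply (continuity_pt_recip_interv f g (g y - 1) (g y + 1)).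
    - lra.
    - intros; now apply Hinc.
    - intros x _ _; apply Hfg.
    - intros x H1 H2; split; apply Hmon; now rewrite Hfg.
    - intros a _; apply derivable_continuous_pt.
      exists (df a); apply is_derive_Reals, Hf.
    - rewrite <- (Hfg y) at 2 3; split; apply Hinc; lra. }
  (* The derivability proof is an explicit [exist], so that [derive_pt] reduces to [df (g y)]. *)
  set (Prf := fun (a : R) (_ : g (y - 1) <= a <= g (y + 1)) =>
    exist (fun l => derivable_pt_lim f a l) (df a)
      (proj1 (is_derive_Reals f a (df a)) (Hf a)) : derivable_pt f a).
  assert (Hg : g (y - 1) <= g y <= g (y + 1)).
  { split; apply Hmon; rewrite !Hfg; lra. }
  apply is_derive_Reals.
  replace (/ df (g y)) with (1 / derive_pt f (g y) (Prf (g y) Hg))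
    by (simpl; unfold Rdiv; ring).
  apply (derivable_pt_lim_recip_interv f g (y - 1) (y + 1)); try lra; auto.
  - intros x _; apply Hfg.
  - simpl; specialize (Hp (g y)); lra.
Qed.

Local Notation R2n := (prod_NormedModule R_AbsRing R_NormedModule R_NormedModule).

(** * The zeroth-order fields: signs, vanishing and continuity *)

Section Fluid.
Context (c m q : R) (alpha : R -> R2).
Context (alpha_C2 : is_C2_vec alpha).
Context (alpha_0 : forall xi : R, xi <= 0 -> alpha xi = (0, 0)).

Local Notation up := (u_perp c m q alpha).
Local Notation uz := (u_z c m q alpha).
Local Notation gam := (gamma c m q alpha).
Local Notation Y := (Y_vec c m q alpha).
Local Notation XI := (Xi c m q alpha).
Local Notation XIi := (Xi_inv c m q alpha).

(** Squaring removes the root in the Euclidean norm; positivity and continuity are then read off a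
    polynomial in the components. *)
Lemma u_zE xi : uz xi = / 2 * (fst (up xi) ^ 2 + snd (up xi) ^ 2).
Proof.
  unfold u_z; f_equal.
  change (norm (up xi)) with
    (sqrt (Rabs (fst (up xi)) ^ 2 + Rabs (snd (up xi)) ^ 2)).
  rewrite pow2_sqrt, !pow2_abs; [ring|].
  apply Rplus_le_le_0_compat; apply pow2_ge_0.
Qed.

Lemma gamma_ge1 xi : 1 <= gam xi.
Proof.
  unfold gamma; rewrite u_zE.
  assert (H1 := pow2_ge_0 (fst (up xi))); assert (H2 := pow2_ge_0 (snd (up xi))); lra.
Qed.

Lemma gamma_gt0 xi : 0 < gam xi.
Proof. generalize (gamma_ge1 xi); lra. Qed.

Lemma u_perp_0 xi : xi <= 0 -> up xi = (0, 0).
Proof.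
  intros H; unfold u_perp; rewrite alpha_0 by easy.
  apply (scal_zero_r (V := R2n)).
Qed.

Lemma u_z_0 xi : xi <= 0 -> uz xi = 0.
Proof. intros H; rewrite u_zE, u_perp_0 by easy; simpl; ring. Qed.

Lemma continuous_u_perp_fst xi : continuous (fun s => fst (up s)) xi.
Proof.
  apply (continuous_scal_r (K := R_AbsRing) (V := R_NormedModule) _
           (fun s => fst (alpha s))).
  apply (ex_derive_continuous (fun s => fst (alpha s))).
  exact (proj1 (proj1 alpha_C2) xi).
Qed.

Lemma continuous_u_perp_snd xi : continuous (fun s => snd (up s)) xi.
Proof.
  apply (continuous_scal_r (K := R_AbsRing) (V := R_NormedModule) _
           (fun s => snd (alpha s))).
  apply (ex_derive_continuous (fun s => snd (alpha s))).
  exact (proj1 (proj2 alpha_C2) xi).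
Qed.

Lemma continuous_u_z xi : continuous uz xi.
Proof.
  apply (continuous_ext (fun s => / 2 * (fst (up s) ^ 2 + snd (up s) ^ 2))).
  { intros s; now rewrite u_zE. }
  apply (continuous_scal_r (K := R_AbsRing) (V := R_NormedModule) (/ 2)
           (fun s => fst (up s) ^ 2 + snd (up s) ^ 2)).
  apply (continuous_plus (V := R_NormedModule)
           (fun s => fst (up s) ^ 2) (fun s => snd (up s) ^ 2)).
  - apply (continuous_comp (fun s => fst (up s)) (fun t => t ^ 2)).
    + apply continuous_u_perp_fst.
    + apply (ex_derive_continuous (fun t => t ^ 2)); auto_derive; auto.
  - apply (continuous_comp (fun s => snd (up s)) (fun t => t ^ 2)).
    + apply continuous_u_perp_snd.
    + apply (ex_derive_continuous (fun t => t ^ 2)); auto_derive; auto.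
Qed.

Lemma continuous_gamma xi : continuous gam xi.
Proof.
  apply (continuous_plus (V := R_NormedModule) (fun _ => 1) uz);
    [apply continuous_const | apply continuous_u_z].
Qed.

(** * The primitives [Xi] and [Y_vec] *)

Lemma is_derive_Xi xi : is_derive XI xi (gam xi).
Proof. apply (is_derive_RInt_continuous gam), continuous_gamma. Qed.

Lemma is_derive_Y_perp xi : is_derive (fun s => fst (Y s)) xi (up xi).
Proof.
  rewrite (surjective_pairing (up xi)).
  apply (is_derive_pair (V := R_NormedModule) (W := R_NormedModule)
           (fun s => fst (fst (Y s))) (fun s => snd (fst (Y s)))).
  - apply (is_derive_RInt_continuous (fun s => fst (up s))), continuous_u_perp_fst.
  - apply (is_derive_RInt_continuous (fun s => snd (up s))), continuous_u_perp_snd.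
Qed.

Lemma Xi_split xi : XI xi = xi + snd (Y xi).
Proof.
  unfold Xi, gamma.
  rewrite (RInt_plus (V := R_CompleteNormedModule) (fun _ => 1) uz).
  - rewrite RInt_const.
    change ((xi - 0) * 1 + RInt uz 0 xi = xi + RInt uz 0 xi); ring.
  - apply ex_RInt_const.
  - apply (ex_RInt_continuous (V := R_CompleteNormedModule)).
    intros; apply continuous_u_z.
Qed.

Lemma RInt_zero_neg (f : R -> R) xi :
  (forall s, s <= 0 -> f s = 0) -> xi <= 0 -> RInt f 0 xi = 0.
Proof.
  intros Hf H.
  rewrite (RInt_ext f (fun _ => 0)).
  - rewrite RInt_const; unfold scal; simpl; unfold mult; simpl; ring.
  (* For [xi <= 0] the interval of integration ends at 0, so every [s] in it is negative. *)
  - rewrite Rmax_left by lra; intros s Hs; apply Hf; lra.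
Qed.

Lemma Y_0 xi : xi <= 0 -> Y xi = ((0, 0), 0).
Proof.
  intros H; unfold Y_vec.
  rewrite !RInt_zero_neg; auto using u_z_0; intros s Hs; now rewrite u_perp_0.
Qed.

Lemma Xi_neg xi : xi <= 0 -> XI xi = xi.
Proof. intros H; rewrite Xi_split, Y_0 by easy; simpl; ring. Qed.

(** * Bijectivity of [Xi] and its inverse *)

Lemma Xi_increasing a b : a < b -> XI a < XI b.
Proof.
  apply (is_derive_increasing XI gam); [apply is_derive_Xi | apply gamma_gt0].
Qed.

Lemma Xi_inj a b : XI a = XI b -> a = b.
Proof.
  intros H; destruct (Rtotal_order a b) as [Hlt|[Heq|Hgt]]; auto;
    [apply Xi_increasing in Hlt | apply Xi_increasing in Hgt]; lra.
Qed.

Lemma Xi_ge_id xi : 0 <= xi -> xi <= XI xi.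
Proof.
  intros H; rewrite Xi_split; simpl.
  enough (0 <= RInt uz 0 xi) by (change (fun s => uz s) with uz; lra).
  apply RInt_ge_0; auto.
  - apply (ex_RInt_continuous (V := R_CompleteNormedModule)).
    intros; apply continuous_u_z.
  - intros x _; generalize (gamma_ge1 x); unfold gamma; lra.
Qed.

(** A nonpositive [y] is a fixed point of [Xi]. A positive [y] lies between [XI 0 = 0] and
    [XI y >= y], and the intermediate value theorem applies on the interval from 0 to [y]. *)
Lemma Xi_surj y : exists xi, XI xi = y.
Proof.
  destruct (Rle_or_lt y 0) as [Hy|Hy].
  { exists y; now apply Xi_neg. }
  assert (H0 : XI 0 = 0) by (apply Xi_neg; lra).
  assert (H1 : y <= XI y) by (apply Xi_ge_id; lra).
  destruct (IVT_gen XI 0 y y) as [x [_ Hx]].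
  - intros x; apply derivable_continuous_pt.
    exists (gam x); apply is_derive_Reals, is_derive_Xi.
  - rewrite H0, Rmin_left, Rmax_right by lra; lra.
  - now exists x.
Qed.

(** Injectivity supplies the uniqueness that pins down the value of [iota]. *)
Lemma Xi_inv_l xi : XIi (XI xi) = xi.
Proof.
  apply (iota_unique (V := R_CompleteNormedModule) (fun x : R => XI x = XI xi)); auto.
  intros y; apply Xi_inj.
Qed.

Lemma Xi_inv_r y : XI (XIi y) = y.
Proof. destruct (Xi_surj y) as [x <-]; now rewrite Xi_inv_l. Qed.

Lemma is_derive_Xi_inv y : is_derive XIi y (/ gam (XIi y)).
Proof.
  apply (is_derive_inverse XI gam XIi);
    [apply is_derive_Xi | apply gamma_gt0 | apply Xi_inv_r].
Qed.

(** * The explicit flow and its inverse *)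

Definition flow (x0 : R) (X : R3) : R3 :=
  (plus (fst X) (fst (Y (XIi (x0 - snd X)))), x0 - XIi (x0 - snd X)).

(** This is the conserved quantity as a function of time and current position. Solving it for the
    position gives [flow], in which [XIi (x0 - snd X)] is the retarded time. *)
Definition flow_inv (x0 : R) (r : R3) : R3 :=
  (minus (fst r) (fst (Y (x0 - snd r))), x0 - XI (x0 - snd r)).

Lemma flow_invK x0 r : flow x0 (flow_inv x0 r) = r.
Proof.
  destruct r as [rp z]; unfold flow, flow_inv; cbn [fst snd].
  replace (x0 - (x0 - XI (x0 - z))) with (XI (x0 - z)) by ring.
  rewrite Xi_inv_l; apply f_equal2; [|ring].
  unfold minus.
  now rewrite <- (plus_assoc (G := R2n)), (plus_opp_l (G := R2n)), (plus_zero_r (G := R2n)).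
Qed.

Lemma flowK x0 X : flow_inv x0 (flow x0 X) = X.
Proof.
  destruct X as [Xp Z]; unfold flow, flow_inv; cbn [fst snd].
  replace (x0 - (x0 - XIi (x0 - Z))) with (XIi (x0 - Z)) by ring.
  rewrite Xi_inv_r; apply f_equal2; [|ring].
  unfold minus.
  now rewrite <- (plus_assoc (G := R2n)), (plus_opp_r (G := R2n)), (plus_zero_r (G := R2n)).
Qed.

Lemma flow_initial x0 X : x0 <= snd X -> flow x0 X = X.
Proof.
  destruct X as [Xp Z]; unfold flow; cbn [fst snd]; intros H.
  (* Up to time [Z] the argument [x0 - Z] is nonpositive: there [Xi] is the identity, so the
     retarded time is [x0 - Z] itself, and [Y] vanishes. *)
  rewrite <- (Xi_neg (x0 - Z)), Xi_inv_l, Y_0 by lra.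
  apply f_equal2; [apply (plus_zero_r (G := R2n)) | ring].
Qed.

(** * The ODE: existence, conservation and uniqueness *)

Lemma one_minus_beta_z xi :
  1 - snd (beta c m q alpha xi) = / gam xi.
Proof.
  change (snd (beta c m q alpha xi)) with (/ gam xi * uz xi).
  (* Since [gamma] is [1 + u_z], the difference [gamma - u_z] is 1; the quotient is the rate of the
     retarded time. *)
  generalize (gamma_gt0 xi); unfold gamma; intros H; field; lra.
Qed.

(** For [l] equal to [/ gam (w x)], the derivative is by conversion the transverse part of [beta] at
    [w x]. *)
Lemma is_derive_Y_perp_comp (w : R -> R) x l :
  is_derive w x l ->
  is_derive (fun t => fst (Y (w t))) x (scal l (up (w x))).
Proof.
  intros Hw.
  apply (is_derive_comp
    (V := R2n)
    (fun s => fst (Y s)) w); [apply is_derive_Y_perp | exact Hw].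
Qed.

Lemma flow_solution : is_solution c m q alpha flow.
Proof.
  split; [|apply flow_initial].
  intros x0 X; unfold flow at 2; simpl snd.
  replace (x0 - (x0 - XIi (x0 - snd X))) with (XIi (x0 - snd X)) by ring.
  assert (Hw : is_derive (fun t => XIi (t - snd X)) x0 (/ gam (XIi (x0 - snd X)))).
  { evar_last.
    - apply (is_derive_comp XIi (fun t => t - snd X));
        [apply is_derive_Xi_inv | auto_derive; auto; reflexivity].
    - unfold scal; simpl; unfold mult; simpl; ring. }
  rewrite (surjective_pairing (beta c m q alpha _)).
  apply (is_derive_pair
    (V := R2n)
    (W := R_NormedModule) (fun t => fst (flow t X)) (fun t => snd (flow t X))).
  - evar_last.
    + apply (is_derive_plus
        (V := R2n)
        (fun _ => fst X) (fun t => fst (Y (XIi (t - snd X)))));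
        [apply is_derive_const | exact (is_derive_Y_perp_comp _ _ _ Hw)].
    + apply (plus_zero_l (G := R2n)).
  - evar_last.
    + apply (is_derive_minus (V := R_NormedModule) (fun t => t)
        (fun t => XIi (t - snd X))); [apply is_derive_id | exact Hw].
    + rewrite <- one_minus_beta_z.
      unfold minus, plus, opp, one; simpl; ring.
Qed.

Lemma flow_inv_conserved (y : R -> R3 -> R3) (X : R3) :
  is_solution c m q alpha y ->
  forall x0, is_derive (fun t => flow_inv t (y t X))
    x0 (zero : prod_NormedModule R_AbsRing
      (R2n) R_NormedModule).
Proof.
  intros [Hd _] x0.
  specialize (Hd x0 X).
  set (w := fun t => t - snd (y t X)).
  assert (Hw : is_derive w x0 (/ gam (w x0))).
  { evar_last.
    - apply (is_derive_minus (V := R_NormedModule) (fun t => t)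
        (fun t => snd (y t X))); [apply is_derive_id | exact (is_derive_snd _ _ _ Hd)].
    - rewrite <- one_minus_beta_z.
      unfold minus, plus, opp, one; simpl; unfold Rminus; reflexivity. }
  apply (is_derive_pair
    (V := R2n)
    (W := R_NormedModule)
    (fun t => fst (flow_inv t (y t X))) (fun t => snd (flow_inv t (y t X)))).
  (* Both the transverse velocity and the derivative of [Y] perp along [w] equal the transverse part
     of [beta], so they cancel. *)
  - evar_last.
    + apply (is_derive_minus
        (V := R2n)
        (fun t => fst (y t X)) (fun t => fst (Y (w t))));
        [exact (is_derive_fst _ _ _ Hd) | exact (is_derive_Y_perp_comp _ _ _ Hw)].
    + apply (minus_eq_zero
        (G := R2n)
        (fst (beta c m q alpha (w x0)))).
  (* Here the derivative is [1 - gam * / gam], which is 0. *)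
  - evar_last.
    + apply (is_derive_minus (V := R_NormedModule) (fun t => t) (fun t => XI (w t)));
        [apply is_derive_id|].
      apply (is_derive_comp XI w); [apply is_derive_Xi | exact Hw].
    + generalize (gamma_gt0 (w x0)); intros Hg.
      unfold minus, plus, opp, one, zero, scal; simpl; unfold mult; simpl.
      field; lra.
Qed.

Lemma solution_unique (y : R -> R3 -> R3) :
  is_solution c m q alpha y -> forall x0 X, y x0 X = flow x0 X.
Proof.
  intros Hy x0 X.
  destruct (Rle_or_lt x0 (snd X)) as [H|H].
  { rewrite flow_initial by easy; now apply Hy. }
  (* It suffices that [flow_inv] sends the position at time [x0] to [X]. Conservation moves this
     claim back to time [snd X], where the position is [X] by the initial condition. *)
  rewrite <- (flow_invK x0 (y x0 X)); f_equal.
  rewrite <- (eq_is_derive _ (snd X) x0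
    (fun t _ => flow_inv_conserved y X Hy t) H).
  rewrite (proj2 Hy) by apply Rle_refl.
  (* Only the position is rewritten, not the time [snd X], so that [flow_inv] meets [flow] at the
     same time. *)
  rewrite <- (flow_initial (snd X) X) at 2 by apply Rle_refl.
  apply flowK.
Qed.

(** * Partial derivatives of the flow and of its inverse *)

Lemma is_derive_retarded_time x0 Z :
  is_derive (fun s => XIi (x0 - s)) Z (- / gam (XIi (x0 - Z))).
Proof.
  evar_last.
  - apply (is_derive_comp XIi (fun s => x0 - s));
      [apply is_derive_Xi_inv | auto_derive; auto; reflexivity].
  - unfold scal; simpl; unfold mult; simpl; ring.
Qed.

Lemma is_derive_flow_z_Z x0 Xp Z :
  is_derive (fun s => snd (flow x0 (Xp, s))) Z
    (1 / gam (x0 - snd (flow x0 (Xp, Z)))).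
Proof.
  unfold flow; simpl.
  replace (x0 - (x0 - XIi (x0 - Z))) with (XIi (x0 - Z)) by ring.
  evar_last.
  - apply (is_derive_minus (V := R_NormedModule) (fun _ => x0) (fun s => XIi (x0 - s)));
      [apply is_derive_const | apply is_derive_retarded_time].
  - unfold minus, plus, opp, zero; simpl; unfold Rdiv; ring.
Qed.

(** [Z] enters only through the retarded time, whose [Z]-derivative is [- / gam]; the chain rule
    turns this factor and [up] into minus the transverse [beta]. *)
Lemma is_derive_flow_perp_Z x0 Xp Z :
  is_derive (fun s => fst (flow x0 (Xp, s))) Z
    (opp (fst (beta c m q alpha (x0 - snd (flow x0 (Xp, Z)))))).
Proof.
  unfold flow; simpl snd; cbn [fst].
  replace (x0 - (x0 - XIi (x0 - Z))) with (XIi (x0 - Z)) by ring.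
  evar_last.
  - apply (is_derive_plus
      (V := R2n)
      (fun _ => Xp) (fun s => fst (Y (XIi (x0 - s)))));
      [apply is_derive_const
      | exact (is_derive_Y_perp_comp _ _ _ (is_derive_retarded_time x0 Z))].
  - etransitivity;
      [apply (plus_zero_l (G := R2n))|].
    apply (scal_opp_l (V := R2n)).
Qed.

Lemma is_derive_flow_inv_z_t x0 xp z :
  is_derive (fun t => snd (flow_inv t (xp, z))) x0 (- uz (x0 - z)).
Proof.
  evar_last.
  - apply (is_derive_minus (V := R_NormedModule) (fun t => t) (fun t => XI (t - z)));
      [apply is_derive_id|].
    apply (is_derive_comp XI (fun t => t - z));
      [apply is_derive_Xi | auto_derive; auto; reflexivity].
  (* At fixed [z] the derivative is [1 - gam], that is, [- uz]. *)
  - unfold minus, plus, opp, one, scal, gamma; simpl; unfold mult; simpl; ring.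
Qed.

Lemma is_derive_flow_inv_z_z x0 xp z :
  is_derive (fun s => snd (flow_inv x0 (xp, s))) z (gam (x0 - z)).
Proof.
  evar_last.
  - apply (is_derive_minus (V := R_NormedModule) (fun _ => x0) (fun s => XI (x0 - s)));
      [apply is_derive_const|].
    apply (is_derive_comp XI (fun s => x0 - s));
      [apply is_derive_Xi | auto_derive; auto; reflexivity].
  - unfold minus, plus, opp, zero, scal; simpl; unfold mult; simpl; ring.
Qed.

End Fluid.

Theorem proposition1 :
  forall (c m q : R) (alpha : R -> R2),
  0 < c -> 0 < m ->
  is_C2_vec alpha ->
  (forall xi : R, xi <= 0 -> alpha xi = (0, 0)) ->
  (forall a b : R, a < b -> Xi c m q alpha a < Xi c m q alpha b) /\
  (forall xi : R, Xi_inv c m q alpha (Xi c m q alpha xi) = xi) /\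
  (forall y : R, Xi c m q alpha (Xi_inv c m q alpha y) = y) /\
  (forall xi : R, Xi c m q alpha xi = xi + snd (Y_vec c m q alpha xi)) /\
  exists (x : R -> R3 -> R3) (X_of : R -> R3 -> R3),
    is_solution c m q alpha x /\
    (forall y : R -> R3 -> R3, is_solution c m q alpha y ->
       forall (x0 : R) (X : R3), y x0 X = x x0 X) /\
    (forall (x0 : R) (X : R3), X_of x0 (x x0 X) = X) /\
    (forall (x0 : R) (r : R3), x x0 (X_of x0 r) = r) /\
    (forall (x0 : R) (Xp : R2) (Z : R),
       snd (x x0 (Xp, Z)) = x0 - Xi_inv c m q alpha (x0 - Z)) /\
    (forall (x0 : R) (xp : R2) (z : R),
       snd (X_of x0 (xp, z)) = x0 - Xi c m q alpha (x0 - z) /\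
       x0 - Xi c m q alpha (x0 - z) = z - snd (Y_vec c m q alpha (x0 - z))) /\
    (forall (x0 : R) (Xp : R2) (Z : R),
       fst (x x0 (Xp, Z)) =
         plus Xp (fst (Y_vec c m q alpha (x0 - snd (x x0 (Xp, Z)))))) /\
    (forall (x0 : R) (xp : R2) (z : R),
       fst (X_of x0 (xp, z)) = minus xp (fst (Y_vec c m q alpha (x0 - z)))) /\
    (forall (x0 : R) (xp : R2) (z : R),
       is_derive (fun t : R => snd (X_of t (xp, z))) x0
         (- u_z c m q alpha (x0 - z))) /\
    (forall (x0 : R) (xp : R2) (z : R),
       is_derive (fun s : R => snd (X_of x0 (xp, s))) z
         (gamma c m q alpha (x0 - z))) /\
    (forall (x0 : R) (Xp : R2) (Z : R),
       is_derive (fun s : R => snd (x x0 (Xp, s))) Z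
         (1 / gamma c m q alpha (x0 - snd (x x0 (Xp, Z))))) /\
    (forall (x0 : R) (Xp : R2) (Z : R),
       is_derive (fun s : R => fst (x x0 (Xp, s))) Z
         (opp (fst (beta c m q alpha (x0 - snd (x x0 (Xp, Z))))))).
Proof.
  intros c m q alpha _ _ HC2 H0.
  split; [now apply Xi_increasing|].
  split; [now apply Xi_inv_l|].
  split; [now apply Xi_inv_r|].
  split; [now apply Xi_split|].
  exists (flow c m q alpha), (flow_inv c m q alpha).
  split; [now apply flow_solution|].
  split; [now apply solution_unique|].
  split; [now apply flowK|].
  split; [now apply flow_invK|].
  split; [reflexivity|].
  split.
  { intros x0 xp z; split; [reflexivity|].
    rewrite (Xi_split c m q alpha HC2); ring. }
  split.
  (* Subtracting the explicit [z] from [x0] gives back the retarded time at which [flow] evaluates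
     [Y]. *)
  { intros x0 Xp Z; unfold flow; cbn [fst snd].
    replace (x0 - (x0 - Xi_inv c m q alpha (x0 - Z)))
      with (Xi_inv c m q alpha (x0 - Z)) by ring.
    reflexivity. }
  split; [reflexivity|].
  split; [now apply is_derive_flow_inv_z_t|].
  split; [now apply is_derive_flow_inv_z_z|].
  split; [now apply is_derive_flow_z_Z|].
  now apply is_derive_flow_perp_Z.
Qed.
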